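(* Let $A:\mathbb R\to\mathbb R^{n\times n}$ be continuous with $\sup_{t}\|A(t)\|=\mu<\infty$; let $f:\mathbb R\times\mathbb R^n\times\mathbb R^n\to\mathbb R^n$ be continuous in its first argument with $f(t,0,0)=0$ and $\|f(t,y_1,w_1)-f(t,y_2,w_2)\|\le l(\|y_1-y_2\|+\|w_1-w_2\|)$; let $x'=A(t)x$ have an exponential dichotomy on $\mathbb R$ with constants $K,\sigma>0$; and let $lM\theta[1+M(1+l\theta)e^{Ml\theta}]<m$, where $M=e^{\mu\theta}$, $m=e^{-\mu\theta}$. A function $z(t)=(u(t),v(t))$ bounded on $\mathbb R$ is a solution of the reduced system $$u'=B_+(t)u+g_+(t,z(t),z(\beta(t))),\qquad v'=B_-(t)v+g_-(t,z(t),z(\beta(t)))$$ if and only if it is a solution of the system of integral equations $$u(t)=\int_{-\infty}^tU(t,s)g_+(s,z(s),z(\beta(s)))\,ds,\qquad v(t)=-\int_t^\infty V(t,s)g_-(s,z(s),z(\beta(s)))\,ds .$$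
   Context: $\|\cdot\|$ is the Euclidean norm and the induced operator norm. $(\theta_i)_{i\in\mathbb Z}$ is a strictly increasing real sequence with $|\theta_i|\to\infty$ as $|i|\to\infty$ and $\theta_{i+1}-\theta_i\le\theta$ for all $i$, where $\theta>0$; $\beta(t)=\theta_i$ for $\theta_i\le t<\theta_{i+1}$. Exponential dichotomy: for a fundamental matrix $X(t)$ of $x'=A(t)x$ there is a projection $P$ with $\|X(t)PX^{-1}(s)\|\le Ke^{-\sigma(t-s)}$ for $t\ge s$ and $\|X(t)(I-P)X^{-1}(s)\|\le Ke^{-\sigma(s-t)}$ for $t\le s$. Reduced system: the equation $y'=A(t)y+f(t,y(t),y(\beta(t)))$ is transformed by $y=Q(t)z$, where $Q$ is a Lyapunov matrix ($C^1$, with $Q,Q',Q^{-1}$ bounded on $\mathbb R$) block-diagonalizing $x'=A(t)x$ according to the dichotomy, into the displayed system with $z=(u,v)$, $u\in\mathbb R^k$, $v\in\mathbb R^{n-k}$, $k=\operatorname{rank}P$, $\operatorname{diag}\{B_+,B_-\}=Q^{-1}AQ-Q^{-1}Q'$ and $(g_+,g_-)(t,z,w)=Q^{-1}(t)f(t,Q(t)z,Q(\beta(t))w)$. $U(t,s)$ and $V(t,s)$ are the fundamental matrices of $u'=B_+(t)u$ and $v'=B_-(t)v$ with $U(s,s)=I$, $V(s,s)=I$; they satisfy $\|U(t,s)\|\le Ke^{-\sigma(t-s)}$ for $t\ge s$ and $\|V(t,s)\|\le Ke^{-\sigma(s-t)}$ for $t\le s$. A solution on $\mathbb R$ of the reduced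 system is a continuous function on $\mathbb R$, differentiable except possibly at the points $\theta_i$ (where the right derivative exists), satisfying the system on every $(\theta_i,\theta_{i+1})$ and with right derivatives at the $\theta_i$. *)

(* Defs.v *)
From mathcomp Require Export all_boot all_order all_algebra.
From mathcomp Require Export all_classical all_reals all_analysis.
Export Order.TTheory GRing.Theory Num.Theory.
Export numFieldNormedType.Exports.

Set Implicit Arguments.
Unset Strict Implicit.
Unset Printing Implicit Defensive.

Local Open Scope classical_set_scope.
Local Open Scope ring_scope.

(* The norm `|_| that MathComp-Analysis puts on matrices is the maximum norm:
   it induces the right topology, but all quantitative bounds below use the
   Euclidean norm and its induced operator norm. *)
Definition enorm (R : realType) (n : nat) (x : 'cV[R]_n) : R :=
  Num.sqrt (\sum_(i < n) x i ord0 ^+ 2).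

Definition opnorm (R : realType) (m n : nat) (A : 'M[R]_(m, n)) : R :=
  sup [set enorm (A *m x) | x in [set x : 'cV[R]_n | enorm x <= 1]].

Definition vbounded (R : realType) (n : nat) (x : R -> 'cV[R]_n) : Prop :=
  exists C : R, forall t, enorm (x t) <= C.

Definition mxbounded (R : realType) (m n : nat) (F : R -> 'M[R]_(m, n)) : Prop :=
  exists C : R, forall t, opnorm (F t) <= C.

Definition switching_times (R : realType) (theta_ : int -> R) (theta : R) : Prop :=
  [/\ forall i j : int, i < j -> theta_ i < theta_ j,
      forall C : R, exists N : int, forall i : int, N <= `|i| -> C <= `|theta_ i|
    & forall i : int, theta_ (i + 1) - theta_ i <= theta].

(* This determines beta, since the intervals [theta_i, theta_(i+1)[ partition
   the line. *)
Definition switching_function (R : realType) (theta_ : int -> R)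
    (beta : R -> R) : Prop :=
  forall (i : int) (t : R), theta_ i <= t < theta_ (i + 1) -> beta t = theta_ i.

Definition fundamental_matrix (R : realType) (n : nat) (A X : R -> 'M[R]_n) : Prop :=
  forall t : R, X t \in unitmx /\ is_derive t 1 X (A t *m X t).

Definition normalized_fundamental_matrix (R : realType) (n : nat)
    (A : R -> 'M[R]_n) (U : R -> R -> 'M[R]_n) : Prop :=
  forall s : R, fundamental_matrix A (U ^~ s) /\ U s s = 1%:M.

Definition exp_dichotomy (R : realType) (n : nat) (A X : R -> 'M[R]_n)
    (P : 'M[R]_n) (K sigma : R) : Prop :=
  [/\ fundamental_matrix A X,
      P *m P = P,
      forall t s : R, s <= t ->
        opnorm (X t *m P *m invmx (X s)) <= K * expR (- sigma * (t - s))
    & forall t s : R, t <= s ->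
        opnorm (X t *m (1%:M - P) *m invmx (X s)) <= K * expR (- sigma * (s - t))].

Definition lyapunov_matrix (R : realType) (n : nat) (Q : R -> 'M[R]_n) : Prop :=
  [/\ forall t : R, Q t \in unitmx,
      forall t : R, derivable Q t 1,
      continuous (derive1 Q)
    & [/\ mxbounded Q, mxbounded (derive1 Q) & mxbounded (fun t => invmx (Q t))]].

Definition block_diagonalizes (R : realType) (k l : nat)
    (A Q : R -> 'M[R]_(k + l)) (Bp : R -> 'M[R]_k) (Bm : R -> 'M[R]_l) : Prop :=
  forall t : R, block_mx (Bp t) 0 0 (Bm t) =
    invmx (Q t) *m A t *m Q t - invmx (Q t) *m derive1 Q t.

Definition reduced_nonlinearity (R : realType) (n : nat) (Q : R -> 'M[R]_n)
    (beta : R -> R) (f : R -> 'cV[R]_n -> 'cV[R]_n -> 'cV[R]_n)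
    (t : R) (z w : 'cV[R]_n) : 'cV[R]_n :=
  invmx (Q t) *m f t (Q t *m z) (Q (beta t) *m w).

Definition right_derivative (R : realType) (n : nat) (x : R -> 'cV[R]_n)
    (t : R) (d : 'cV[R]_n) : Prop :=
  (h^-1 *: (x (t + h) - x t)) @[h --> 0^'+] --> d.

(* Here gp and gm are the two blocks of the nonlinearity (g_+ and g_-). *)
Definition reduced_solution (R : realType) (k l : nat)
    (theta_ : int -> R) (beta : R -> R)
    (Bp : R -> 'M[R]_k) (Bm : R -> 'M[R]_l)
    (gp : R -> 'cV[R]_(k + l) -> 'cV[R]_(k + l) -> 'cV[R]_k)
    (gm : R -> 'cV[R]_(k + l) -> 'cV[R]_(k + l) -> 'cV[R]_l)
    (u : R -> 'cV[R]_k) (v : R -> 'cV[R]_l) : Prop :=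
  let z t := col_mx (u t) (v t) in
  let du t := Bp t *m u t + gp t (z t) (z (beta t)) in
  let dv t := Bm t *m v t + gm t (z t) (z (beta t)) in
  [/\ continuous z,
      forall (i : int) (t : R), theta_ i < t < theta_ (i + 1) ->
        is_derive t 1 u (du t) /\ is_derive t 1 v (dv t)
    & forall i : int,
        right_derivative u (theta_ i) (du (theta_ i)) /\
        right_derivative v (theta_ i) (dv (theta_ i))].

(* The vector-valued integral is taken componentwise.  Integrability has to be
   asserted: Rintegral is total, with junk values otherwise. *)
Definition is_vintegral (R : realType) (n : nat) (D : set R)
    (F : R -> 'cV[R]_n) (I : 'cV[R]_n) : Prop :=
  forall i : 'I_n,
    (@lebesgue_measure R).-integrable D (EFin \o (fun s => F s i ord0)) /\
    I i ord0 = \int[@lebesgue_measure R]_(s in D) (F s i ord0).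

Definition integral_solution (R : realType) (k l : nat) (beta : R -> R)
    (U : R -> R -> 'M[R]_k) (V : R -> R -> 'M[R]_l)
    (gp : R -> 'cV[R]_(k + l) -> 'cV[R]_(k + l) -> 'cV[R]_k)
    (gm : R -> 'cV[R]_(k + l) -> 'cV[R]_(k + l) -> 'cV[R]_l)
    (u : R -> 'cV[R]_k) (v : R -> 'cV[R]_l) : Prop :=
  let z t := col_mx (u t) (v t) in
  forall t : R,
    is_vintegral `]-oo, t] (fun s => U t s *m gp s (z s) (z (beta s))) (u t) /\
    is_vintegral `[t, +oo[ (fun s => V t s *m gm s (z s) (z (beta s))) (- v t).

(* Main.v *)
(* With W(t) = U(0,t) u(t), variation of constants says that u solves
   u' = B u + g off the switching times iff every coordinate of W is an
   indefinite integral of the corresponding coordinate of h(s) = U(0,s) g(s).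
   On each interval [theta_i, theta_(i+1)[ the nonlinearity evaluated along a
   continuous z agrees with a function that is continuous on the whole line,
   so an indefinite integral of h is there the restriction of a C^1 function;
   this gives the derivatives inside the intervals and the right derivatives
   at the theta_i at once.  Conversely W minus an indefinite integral of h is
   continuous with zero derivative off the theta_i, hence a constant c; with
   the half-line integral, c = U(0,t) y(t) for a bounded y, which decays
   exponentially as t goes to -oo (to +oo for the V block), so c = 0. *)
From mathcomp Require Import measurable_realfun lra.
Require Import Defs.

Set Implicit Arguments.
Unset Strict Implicit.
Unset Printing Implicit Defensive.

Local Open Scope classical_set_scope.
Local Open Scope ring_scope.

(** * Matrix calculus by entries *)


Section euclidean_norm.
Context {R : realType}.

Lemma normr_coord_le_enorm n (x : 'cV[R]_n) i : `|x i ord0| <= enorm x.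
Proof.
rewrite /enorm -sqrtr_sqr ler_wsqrtr// (bigD1 i)//= lerDl.
by apply: sumr_ge0 => j _; exact: sqr_ge0.
Qed.

(** The factor [n] is cruder than its square root; this suffices because only boundedness and
    continuity are drawn from the estimate. *)
Lemma enorm_le_coord n (x : 'cV[R]_n) (c : R) : 0 <= c ->
  (forall i, `|x i ord0| <= c) -> enorm x <= n%:R * c.
Proof.
move=> c0 xc; rewrite /enorm -(ger0_norm (mulr_ge0 (ler0n R n) c0)) -sqrtr_sqr.
apply: ler_wsqrtr; apply: (@le_trans _ _ (\sum_(i < n) c ^+ 2)).
  by apply: ler_sum => i _; rewrite -real_normK ?num_real// lerXn2r ?nnegrE.
rewrite sumr_const card_ord exprMn -[leLHS]mulr_natl ler_wpM2r ?sqr_ge0//.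
by rewrite -natrX ler_nat; case: n {x xc} => // n; rewrite expnS leq_pmulr.
Qed.

Lemma enorm_mulmx_le m n (A : 'M[R]_(m, n)) (x : 'cV[R]_n) (a c : R) :
  0 <= a -> 0 <= c -> (forall i j, `|A i j| <= a) ->
  (forall j, `|x j ord0| <= c) -> enorm (A *m x) <= m%:R * (n%:R * (a * c)).
Proof.
move=> a0 c0 Aa xc; apply: enorm_le_coord; first by rewrite !mulr_ge0.
move=> i; rewrite mxE (le_trans (ler_norm_sum _ _ _))//.
apply: (@le_trans _ _ (\sum_(j < n) a * c)).
  by apply: ler_sum => j _; rewrite normrM ler_pM.
by rewrite sumr_const card_ord mulr_natl.
Qed.

(** An entry is a coordinate of the image of a basis vector, and basis vectors lie in the unit
    ball. *)
Lemma normr_coord_le_opnorm m n (A : 'M[R]_(m, n)) i j :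
  `|A i j| <= opnorm A.
Proof.
have -> : A i j = (A *m (delta_mx j 0 : 'cV_n)) i ord0 by rewrite -colE mxE.
apply: (@le_trans _ _ (enorm (A *m (delta_mx j 0 : 'cV_n)))).
  exact: normr_coord_le_enorm.
apply: ub_le_sup; last first.
  exists (delta_mx j 0) => //=; rewrite /enorm (bigD1 j)//= big1 ?addr0.
    by rewrite mxE !eqxx expr1n sqrtr1.
  by move=> l lj; rewrite mxE (negbTE lj) expr0n.
(* [sup] is meaningful only for a set bounded above; the maximum norm of [A] bounds the image of the
   unit ball. *)
have [a a0 Aa] : exists2 a : R, 0 <= a & forall i j, `|A i j| <= a.
  by exists `|A| => // i' j'; rewrite [leRHS]/Num.Def.normr/= mx_normrE;
    exact: (le_bigmax _ _ (i', j')).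
exists (m%:R * (n%:R * (a * 1))) => _ [x /= x1 <-].
apply: enorm_mulmx_le => // k.
exact: le_trans (normr_coord_le_enorm _ _) x1.
Qed.

End euclidean_norm.

Section entrywise.
Context {R : realType}.

(** The matrix norm is a maximum over finitely many entries, so finitely many filter sets can be
    intersected. *)
Lemma cvg_mxP (T : Type) (F : set_system T) {FF : Filter F} m n
    (M : T -> 'M[R]_(m, n)) (L : 'M[R]_(m, n)) :
  M x @[x --> F] --> L <-> forall i j, M x i j @[x --> F] --> L i j.
Proof.
split=> [ML i j|ML].
  exact: (cvg_comp _ _ ML (@coord_continuous _ _ _ i j L)).
apply/cvgrPdist_le => e e0.
near=> x.
rewrite [leLHS]/Num.Def.normr/= mx_normrE (bigmax_le _ (ltW e0))// => -[i j] _.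
rewrite !mxE/=; move: i j; near: x.
apply: filter_forall => i; apply: filter_forall => j.
exact: ((cvgrPdist_le _ _).1 (ML i j)).
Unshelve. all: by end_near. Qed.

Lemma is_derive_mxP m n (M : R -> 'M[R]_(m, n)) (t : R) dM :
  is_derive t 1 M dM <->
  forall i j, is_derive t 1 (fun s => M s i j) (dM i j).
Proof.
split=> [[Mt <-] i j|H].
  by split; [exact: (derivable_mxP M t 1).1 Mt i j|rewrite derive_mx// mxE].
have Mt : derivable M t 1 by apply/derivable_mxP => i j; exact: ex_derive.
split=> //; rewrite derive_mx//; apply/matrixP => i j; rewrite mxE.
exact: derive_val.
Qed.

Lemma derivable_continuous (V : normedModType R) (f : R -> V) (t : R) :
  derivable f t 1 -> {for t, continuous f}.
Proof. by move=> /derivable1_diffP/differentiable_continuous. Qed.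

Lemma is_derive_mulmx m n p (M : R -> 'M[R]_(m, n)) (N : R -> 'M[R]_(n, p))
    (t : R) dM dN :
  is_derive t 1 M dM -> is_derive t 1 N dN ->
  is_derive t 1 (fun s => M s *m N s) (dM *m N t + M t *m dN).
Proof.
move=> /is_derive_mxP MdM /is_derive_mxP NdN; apply/is_derive_mxP => i j.
have -> : (fun s => (M s *m N s) i j) =
    \sum_(k < n) ((fun s => M s i k) * (fun s => N s k j)).
  by apply/funext => s; rewrite fct_sumE mxE.
apply: is_derive_eq.
rewrite !mxE -big_split/=; apply: eq_bigr => k _.
by rewrite addrC /GRing.scale/= (mulrC (N t k j)).
Qed.

Lemma cvg_mulmx (T : Type) (F : set_system T) {FF : Filter F} m n p
    (M : T -> 'M[R]_(m, n)) (N : T -> 'M[R]_(n, p))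
    (M0 : 'M[R]_(m, n)) (N0 : 'M[R]_(n, p)) :
  M x @[x --> F] --> M0 -> N x @[x --> F] --> N0 ->
  M x *m N x @[x --> F] --> M0 *m N0.
Proof.
move=> /cvg_mxP MM0 /cvg_mxP NN0; apply/cvg_mxP => i j.
rewrite mxE; under eq_fun do rewrite mxE.
apply: cvg_big => [|k _]; first exact: add_continuous.
by apply: cvgM.
Qed.

(** The shape of the Leibniz expansion of [\det]: [I] stands for the permutations, [c] for their
    signs, [J] for the row indices. *)
Lemma derivable_sum_prod (I J : Type) (r : seq I) (q : I -> seq J)
  (c : I -> R) (f : I -> J -> R -> R) (t : R) :
  (forall i j, derivable (f i j) t 1) ->
  derivable (fun s => \sum_(i <- r) c i * \prod_(j <- q i) f i j s) t 1.
Proof.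
move=> df; elim: r => [|i r IH].
  by under eq_fun do rewrite big_nil; exact: derivable_cst.
under eq_fun do rewrite big_cons.
apply: derivableD => //; apply: derivableM; first exact: derivable_cst.
elim: (q i) => [|j s IHs].
  by under eq_fun do rewrite big_nil; exact: derivable_cst.
by under eq_fun do rewrite big_cons; exact: derivableM.
Qed.

Lemma derivable_det n (M : R -> 'M[R]_n) (t : R) :
  derivable M t 1 -> derivable (fun s => \det (M s)) t 1.
Proof.
move=> /derivable_mxP dM.
by apply: (@derivable_sum_prod _ _ _ _ _ (fun _ _ s => M s _ _)).
Qed.

(** By Cramer's rule an entry of the inverse is a cofactor over the determinant. Invertibility at
    every [s] makes this an identity of functions. *)
Lemma derivable_invmx n (M : R -> 'M[R]_n) (t : R) :
  (forall s, M s \in unitmx) -> derivable M t 1 ->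
  derivable (fun s => invmx (M s)) t 1.
Proof.
move=> Mu dM; apply/derivable_mxP => i j.
have -> : (fun s => invmx (M s) i j) =
   (fun s => (\det (M s))^-1) * (fun s => cofactor (M s) j i).
  by apply/funext => s; rewrite /invmx Mu !mxE.
apply: derivableM.
  apply: derivableV; last exact: derivable_det.
  by have := Mu t; rewrite unitmxE unitfE.
rewrite /cofactor; apply: derivableM; first exact: derivable_cst.
apply: derivable_det; apply/derivable_mxP => i' j'.
by under eq_fun do rewrite !mxE; exact: (derivable_mxP M t 1).1.
Qed.

End entrywise.

(** * Fundamental matrices: inverse, cocycle identity, adjoint equation *)

Section fundamental_matrices.
Context {R : realType} {n : nat} (A : R -> 'M[R]_n).

(** Differentiating [invmx (X s) *m X s = 1%:M] gives the derivative of the inverse after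
    multiplication by [invmx (X t)] on the right. *)
Lemma is_derive_fundamental_inv (X : R -> 'M[R]_n) (t : R) :
  fundamental_matrix A X ->
  is_derive t 1 (fun s => invmx (X s)) (- (invmx (X t) *m A t)).
Proof.
move=> XA; have Xu s := (XA s).1.
have dX : derivable X t 1 by have [_ ?] := XA t; exact: ex_derive.
have dY := derivableP (derivable_invmx Xu dX).
have := is_derive_mulmx dY (XA t).2.
have -> : (fun s => invmx (X s) *m X s) = cst 1%:M.
  by apply/funext => s; rewrite mulVmx.
move=> d1; have := @derive_val _ _ _ _ _ _ _ d1.
rewrite derive_cst => /esym/eqP; rewrite addr_eq0 => /eqP.
move=> /(congr1 (fun Z => Z *m invmx (X t))).
rewrite mulmxA mulNmx -!mulmxA mulmxV// !mulmx1 => dYE.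
by rewrite -dYE.
Qed.

Lemma is_derive0_eq (m p : nat) (F : R -> 'M[R]_(m, p)) (s t : R) :
  (forall x : R, is_derive x 1 F 0) -> F s = F t.
Proof.
move=> F0; apply/matrixP => i j.
apply: (@is_derive_0_is_cst _ (fun x => F x i j)) => x.
by have := (is_derive_mxP _ _ _).1 (F0 x) i j; rewrite mxE.
Qed.

Variable U : R -> R -> 'M[R]_n.
Hypothesis UA : normalized_fundamental_matrix A U.

(** Uniqueness of solutions in disguise: [invmx (U x s) *m U x r] has zero derivative in [x], so its
    values at [x = t] and [x = s] agree. *)
Lemma fundamental_mul t s r : U t s *m U s r = U t r.
Proof.
have [UAs Us] := UA s; have [UAr Ur] := UA r.
have H : invmx (U t s) *m U t r = invmx (U s s) *m U s r.
  apply: (is_derive0_eq (F := fun x => invmx (U x s) *m U x r)) => x.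
  have := is_derive_mulmx (is_derive_fundamental_inv x UAs) (UAr x).2.
  by rewrite mulNmx -mulmxA addrC subrr.
rewrite -[U s r]mul1mx -[1%:M]invmx1 -Us -H mulmxA mulmxV ?mul1mx//.
exact: (UAs t).1.
Qed.

Lemma fundamental_mulV t s : U t s *m U s t = 1%:M.
Proof. by rewrite fundamental_mul (UA t).2. Qed.

(** In its second argument [U] solves the adjoint equation, since [U s x] is the inverse of
    [U x s]. *)
Lemma is_derive_fundamental_snd (s t : R) :
  is_derive t 1 (U s) (- (U s t *m A t)).
Proof.
have -> : U s = fun x => invmx (U x s).
  apply/funext => x; have Uu := ((UA s).1 x).1.
  by rewrite -[RHS]mul1mx -(fundamental_mulV s x) mulmxK.
exact: is_derive_fundamental_inv (UA s).1.
Qed.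

End fundamental_matrices.

(** * Indefinite integrals *)


Section primitives.
Context {R : realType}.
Notation mu := (@lebesgue_measure R).
Implicit Types h H : R -> R.

(** Only increments of [H] are prescribed, so the integrals over both kinds of half-line qualify,
    whatever their additive constants. *)
Definition primitive h H := forall a b : R, a <= b ->
  mu.-integrable `[a, b] (EFin \o h) /\
  H b - H a = \int[mu]_(s in `[a, b]) h s.

Lemma primitive_itvNy h :
  (forall t, mu.-integrable `]-oo, t] (EFin \o h)) ->
  primitive h (fun t => \int[mu]_(s in `]-oo, t]) h s).
Proof.
move=> hi a b ab; have hab : mu.-integrable `[a, b] (EFin \o h).
  by apply: integrableS (hi b) => //; exact: subset_itvr.
split=> //; rewrite Rintegral_itvB ?bnd_simp// Rintegral_itv_obnd_cbnd//.
by apply: integrableS hab => //; exact: subset_itv_oc_cc.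
Qed.

Lemma primitive_itvy h :
  (forall t, mu.-integrable `[t, +oo[ (EFin \o h)) ->
  primitive h (fun t => - \int[mu]_(s in `[t, +oo[) h s).
Proof.
move=> hi a b ab; have hab : mu.-integrable `[a, b] (EFin \o h).
  by apply: integrableS (hi a) => //; exact: subset_itvl.
split=> //; rewrite opprK addrC.
rewrite -(Rintegral_itv_obnd_cbnd (r := b)); last first.
  by apply: integrableS (hi b) => //; apply: subset_itvr; rewrite bnd_simp.
by rewrite -(@Rintegral_itvB _ _ (BLeft a) +oo%O b)// opprB addrC subrK.
Qed.

(** Near [t], [H] is the constant [H (t - 1)] plus an integral with base point [t - 1], which is
    continuous in its upper limit. *)
Lemma primitive_continuous h H : primitive h H -> continuous H.
Proof.
move=> hH t.
have t1t1 : t - 1 < t + 1 by rewrite ltrBlDr -addrA ltrDl.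
have [hi _] := hH _ _ (ltW t1t1).
have /(continuous_within_itvP _ t1t1)[c _ _] :=
  parameterized_integral_continuous (ltW t1t1) hi.
have tin : t \in `]t - 1, t + 1[ by rewrite in_itv/= ltrBlDr ltrDl ltr01.
have {c}c := c t tin.
have : {for t, continuous
    (fun x => H (t - 1) + parameterized_integral mu (t - 1) x h)}.
  by apply: cvgD; [exact: cvg_cst|exact: c].
rewrite /prop_for /continuous_at.
have HE x : t - 1 <= x ->
    H (t - 1) + parameterized_integral mu (t - 1) x h = H x.
  by move=> tx; rewrite /parameterized_integral -(hH _ _ tx).2 addrC subrK.
rewrite HE; last by rewrite lerBlDr lerDl.
apply: cvg_trans; apply: near_eq_cvg.
near=> x; apply: HE.
have : x \in `]t - 1, t + 1[ by near: x; exact: near_in_itvoo.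
by rewrite in_itv/= => /andP[/ltW].
Unshelve. all: by end_near. Qed.

(* [phi] is continuous on the whole line, so that [Phi] is differentiable also
   at the endpoint [a], where [H] may only have one-sided derivatives. *)
Lemma primitive_piece h H (phi : R -> R) (a b : R) :
  primitive h H -> continuous phi -> {in `[a, b[, h =1 phi} ->
  exists Phi : R -> R,
    (forall t : R, a <= t -> is_derive t 1 Phi (phi t)) /\
    {in `[a, b], H =1 Phi}.
Proof.
move=> hH cphi hphi.
have iphi c d : mu.-integrable `[c, d] (EFin \o phi).
  apply: continuous_compact_integrable; first exact: segment_compact.
  exact: continuous_subspaceT.
(* The base point lies strictly left of [a], so [a] is interior when the fundamental theorem of
   calculus is applied. *)
pose F x := \int[mu]_(s in `[a - 1, x]) phi s.
have a1 : a - 1 < a by rewrite ltrBlDr ltrDl.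
exists (fun t => H a - F a + F t); split=> [t at_|t].
  have [dF FE] : derivable F t 1 /\ derive1 F t = phi t.
    apply: (@continuous_FTC1_closed _ _ _ _ (t + 1)) => //.
    - by rewrite ltrDl.
    - exact: lt_le_trans a1 at_.
    - exact: cphi.
  have F' : is_derive t 1 F (phi t).
    by apply: DeriveDef => //; rewrite -derive1E.
  have -> : (fun x => H a - F a + F x) = cst (H a - F a) + F by [].
  by apply: is_derive_eq; rewrite add0r.
rewrite in_itv/= => /andP[at_ tb].
have [hi HE] := hH _ _ at_.
have -> : F t = F a + \int[mu]_(s in `[a, t]) phi s.
  rewrite -(Rintegral_itv_obnd_cbnd (r := a)); last first.
    by apply: integrableS (iphi a t) => //; exact: subset_itv_oc_cc.
  rewrite -(@Rintegral_itvB _ _ (BLeft (a - 1)) (BRight t) a)//; last first.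
    by rewrite bnd_simp ltW.
  by rewrite addrC subrK.
rewrite addrA subrK.
(* [h] and [phi] may differ at [b]; the right endpoint is dropped from both integrals as a null
   set. *)
have -> : \int[mu]_(s in `[a, t]) phi s = \int[mu]_(s in `[a, t]) h s.
  rewrite -!Rintegral_itv_bndo_bndc.
  - apply: eq_Rintegral => s; rewrite inE/= in_itv/= => /andP[as_ st].
    by rewrite hphi// in_itv/= as_ (lt_le_trans st).
  - by apply: integrableS hi => //; exact: subset_itv_co_cc.
  - by apply: integrableS (iphi a t) => //; exact: subset_itv_co_cc.
by rewrite -HE addrC subrK.
Qed.

End primitives.

(** * Exponential weights on half-lines *)

Section exponential_bounds.
Context {R : realType}.
Notation mu := (@lebesgue_measure R).

Lemma integral_expR_itvy (k a : R) : 0 < k ->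
  (\int[mu]_(s in `[a, +oo[) (expR (- k * (s - a)))%:E = (k^-1)%:E)%E.
Proof.
(* The antiderivative that vanishes at [+oo]; its value at [a] is [- k^-1]. *)
move=> k0; pose F s : R := - (k^-1 * expR (- k * (s - a))).
have dF (x : R) : is_derive x 1 F (expR (- k * (x - a))).
  have di : is_derive x 1 (fun s : R => - k * (s - a)) (- k).
    have -> : (fun s : R => - k * (s - a)) = (- k) \*: (id - cst a) by [].
    by apply: is_derive_eq; rewrite subr0 /GRing.scale/= mulr1.
  have de : is_derive x 1 (expR \o (fun s : R => - k * (s - a)))
      (- k * expR (- k * (x - a))).
    by apply: is_derive_eq; rewrite mulrC.
  have -> : F = (- k^-1) \*: (expR \o (fun s : R => - k * (s - a))).
    by apply/funext => s; exact/esym/mulNr.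
  apply: is_derive_eq.
  by rewrite /GRing.scale/= mulNr mulNr mulrN opprK mulKf// gt_eqF.
have cF x : {for x, continuous F} by apply: derivable_continuous.
rewrite (@ge0_continuous_FTC2y _ _ F a 0).
- by rewrite /F subrr mulr0 expR0 mulr1 sub0e -EFinN opprK.
- by move=> x _; exact: expR_ge0.
- apply: continuous_subspaceT => x.
  apply: continuous_comp; last exact: continuous_expR.
  by apply: cvgM; [exact: cvg_cst|apply: cvgB; [exact: cvg_id|exact: cvg_cst]].
- rewrite -[X in _ --> X]oppr0; apply: cvgN.
  rewrite -[X in _ --> X](mulr0 k^-1); apply: cvgM; first exact: cvg_cst.
  under eq_fun do rewrite mulNr.
  apply: (@cvg_comp _ _ _ (fun x => k * (x - a)) (fun y => expR (- y)) _
    (pinfty_nbhs R)); last exact: cvgr_expR.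
  apply: gt0_cvgMry => //.
  exact: cvg_addrr.
- by move=> x _; exact: ex_derive.
- exact/cvg_at_right_filter/cF.
- by move=> x _; rewrite derive1E; exact: derive_val.
Qed.

Lemma integral_expR_itvNy (k a : R) : 0 < k ->
  (\int[mu]_(s in `]-oo, a]) (expR (- k * (a - s)))%:E = (k^-1)%:E)%E.
Proof.
move=> k0; rewrite -(opprK a) ge0_integration_by_substitutionNy.
- rewrite -(@integral_expR_itvy k (- a))//.
  by apply: eq_integral => s _ /=; rewrite !opprK addrC.
- apply: continuous_subspaceT => x.
  apply: continuous_comp; last exact: continuous_expR.
  by apply: cvgM; [exact: cvg_cst|apply: cvgB; [exact: cvg_cst|exact: cvg_id]].
- by move=> x _; exact: expR_ge0.
Qed.

(** Domination by [C * e] yields integrability and a bound at once; [e] will be an exponential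
    weight with integral [sigma^-1]. *)
Lemma dominated_Rintegral (D : set (measurableTypeR R))
    (e h : measurableTypeR R -> R) (C k : R) :
  measurable D -> measurable_fun setT e -> measurable_fun setT h ->
  (forall s, 0 <= e s) -> (\int[mu]_(s in D) (e s)%:E = k%:E)%E ->
  (forall s, D s -> `|h s| <= C * e s) ->
  mu.-integrable D (EFin \o h) /\ `|\int[mu]_(s in D) h s| <= C * k.
Proof.
move=> mD me mh e0 eE hC.
have ie : mu.-integrable D (EFin \o e).
  apply/integrableP; split.
    exact/measurable_EFinP/measurable_funTS.
  under eq_integral do rewrite /= ger0_norm//.
  by rewrite eE ltry.
have iCe : mu.-integrable D (EFin \o (fun s => C * e s)).
  rewrite (_ : _ \o _ = fun s => C%:E * (e s)%:E)%E; last by apply/funext.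
  exact: (integrableZl mD C ie).
have ih : mu.-integrable D (EFin \o h).
  apply: le_integrable iCe => //; first exact/measurable_EFinP/measurable_funTS.
  move=> x Dx; rewrite lee_fin (le_trans (hC _ Dx))//.
  exact: ler_norm.
split=> //; apply: (le_trans (le_normr_Rintegral mD ih)).
apply: (@le_trans _ _ (\int[mu]_(s in D) (C * e s))).
  by apply: le_Rintegral => //; exact: (integrable_norm ih).
by rewrite RintegralZl// /Rintegral eE.
Qed.

(** If [c] were nonzero, the linear lower bound [1 + k * s] of the exponential would already exceed
    any [C]. *)
Lemma expR_bounded_eq0 (c C k : R) : 0 < k ->
  (forall s, 0 <= s -> `|c| * expR (k * s) <= C) -> c = 0.
Proof.
move=> k0 H; apply/eqP; rewrite -normr_eq0; apply/eqP/le_anti.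
rewrite normr_ge0 andbT leNgt; apply/negP => c0.
have C0 : 0 <= C by apply: le_trans (H 0 (lexx _)); rewrite mulr_ge0 ?expR_ge0.
(* At this [s] the linear bound gives [|c| * (1 + k * s) = |c| + C], which is greater than [C]. *)
have := H (C / (`|c| * k)) (divr_ge0 C0 (mulr_ge0 (ltW c0) (ltW k0))).
apply/negP; rewrite -ltNge.
apply: (@lt_le_trans _ _ (`|c| * (1 + k * (C / (`|c| * k))))); last first.
  by rewrite ler_pM2l// expR_ge1Dx.
have E (x : R) : 0 < x -> x * (k * (C / (x * k))) = C.
  by move=> x0; rewrite mulrA mulrC divfK// mulf_neq0// gt_eqF.
by rewrite mulrDr mulr1 E// ltrDr.
Qed.

End exponential_bounds.

(** * Piecewise continuity along the switching times *)


Section switching.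
Context {R : realType} (theta_ : int -> R) (theta : R).
Hypothesis theta_switching : switching_times theta_ theta.

Lemma switching_lt i : theta_ i < theta_ (i + 1).
Proof. by have [H _ _] := theta_switching; rewrite H// ltrDl. Qed.

(** Divergence and monotonicity put [t] between [theta_ (- n)] and [theta_ n]; an induction over the
    indices between them finds the cell. *)
Lemma switching_bracket t : exists i, theta_ i <= t < theta_ (i + 1).
Proof.
have [incr div _] := theta_switching.
(* The term [|theta_ 0| + 1] fixes signs: [theta_ n] lies above [theta_ 0], so with so large a
   modulus it must be positive, and dually [theta_ (- n)] is negative. *)
have [N HN] := div (`|t| + `|theta_ 0| + 1).
pose n := `|N|%N.+1.
have big (i : int) : `|i| = n%:Z -> `|t| + `|theta_ 0| + 1 <= `|theta_ i|.
  move=> iE; apply: HN; rewrite iE /n (le_trans (ler_norm N))//.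
  by rewrite -abszE lez_nat.
have n0 : 0 < n%:Z by [].
have t0 := normr_ge0 t; have th0 := normr_ge0 (theta_ 0).
have tn : t < theta_ n.
  have := big n%:Z (gtr0_norm n0); have := incr _ _ n0.
  have := ler_norm t; have := ler_norm (- theta_ 0); rewrite normrN.
  by case: (ger0P (theta_ n)); lra.
have nt : theta_ (- n%:Z) <= t.
  have := big (- n%:Z); rewrite normrN => /(_ (gtr0_norm n0)).
  have : theta_ (- n%:Z) < theta_ 0 by apply: incr; rewrite oppr_lt0.
  have := ler_norm (- t); rewrite normrN; have := ler_norm (theta_ 0).
  by case: (ger0P (theta_ (- n%:Z))); lra.
have [m mE] : exists m : nat, n%:Z = - n%:Z + m.
  by exists (n + n)%N; rewrite PoszD addKr.
(* The left index becomes arbitrary and the right one is [a + m], ready for induction on [m]. *)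
rewrite {}mE in tn; move: (- n%:Z) nt tn => a.
elim: m => [|m IH] at_ ta.
  by move: (le_lt_trans at_ ta); rewrite addr0 ltxx.
have [tam|tam] := ltP t (theta_ (a + m)); first exact: IH.
by exists (a + m); rewrite tam/= -addrA -PoszD addn1.
Qed.

(** Asking for a continuous [phi] on the whole line forces a finite left limit at the right end of
    each cell; cells closed on the left match the right derivatives at [theta_ i]. *)
Definition piecewise_continuous (T : topologicalType) (h : R -> T) :=
  forall i, exists2 phi : R -> T, continuous phi &
    {in `[theta_ i, theta_ (i + 1)[, h =1 phi}.

Lemma piecewise_continuous_measurable (h : R -> R) :
  piecewise_continuous h -> measurable_fun [set: measurableTypeR R] h.
Proof.
move=> hphi.
(* The cells are enumerated by natural numbers through [unpickle]; numbers that code no integer get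
   the empty set. *)
pose E (n : nat) : set (measurableTypeR R) :=
  if unpickle n is Some i then `[theta_ i, theta_ (i + 1)[%classic else set0.
have -> : [set: measurableTypeR R] = \bigcup_n E n.
  apply/esym/seteqP; split=> // t _; have [i it] := switching_bracket t.
  by exists (pickle i) => //; rewrite /E pickleK/= in_itv.
apply/measurable_fun_bigcup => n; rewrite /E; case: unpickle => [i|] //.
  by have [phi cphi hE] := hphi i; apply: (eq_measurable_fun phi);
    [move=> x; rewrite inE => xi; rewrite hE
    |apply: measurable_funTS; exact: continuous_measurable_fun].
exact: measurable_fun_set0.
Qed.

(** The mean value theorem makes [D] constant on each closed cell, and neighbouring cells share an
    endpoint. *)
Lemma piecewise_derive0_cst (D : R -> R) : continuous D ->
  (forall (i : int) (t : R), theta_ i < t < theta_ (i + 1) ->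
     is_derive t 1 D 0) ->
  forall s t, D s = D t.
Proof.
move=> cD dD.
have piece i t : theta_ i <= t <= theta_ (i + 1) -> D t = D (theta_ i).
  move=> /andP[it ti].
  have [x|c _] := @MVT_segment _ D (cst 0) _ _ it _ (continuous_subspaceT cD).
    rewrite in_itv/= => /andP[ix xt].
    by apply: (dD i); rewrite ix (lt_le_trans xt).
  by rewrite mul0r => /eqP; rewrite subr_eq0 => /eqP.
have next i : D (theta_ (i + 1)) = D (theta_ i).
  by apply: piece; rewrite lexx ltW// switching_lt.
have all0 i : D (theta_ i) = D (theta_ 0).
  elim/int_ind : i => // n IH; first by rewrite -addn1 PoszD next.
  by rewrite -IH -next -addn1 PoszD opprD subrK.
suff all t : D t = D (theta_ 0) by move=> s t; rewrite !all.
have [i /andP[it ti]] := switching_bracket t.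
by rewrite (piece i) ?it ?ltW.
Qed.

End switching.

(** * Variation of constants *)


Section vector_integrals.
Context {R : realType}.
Notation mu := (@lebesgue_measure R).

Lemma Rintegral_lincomb (D : set (measurableTypeR R)) (I : Type) (r : seq I)
    (c : I -> R) (f : I -> measurableTypeR R -> R) :
  measurable D -> (forall i, mu.-integrable D (EFin \o f i)) ->
  mu.-integrable D (EFin \o (fun s => \sum_(i <- r) c i * f i s)) /\
  \int[mu]_(s in D) (\sum_(i <- r) c i * f i s) =
  \sum_(i <- r) c i * \int[mu]_(s in D) f i s.
Proof.
move=> mD fi; elim: r => [|i r [IHi IHE]].
  split; first by under eq_fun do rewrite big_nil; exact: integrable0.
  under eq_Rintegral do rewrite big_nil.
  by rewrite Rintegral_cst// mul0r big_nil.
have cfi : mu.-integrable D (EFin \o (fun s => c i * f i s)).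
  have := integrableZl mD (c i) (fi i); apply: eq_integrable => // x _.
split.
  have := integrableD mD cfi IHi; apply: eq_integrable => // x _.
  by rewrite /= big_cons EFinD.
under eq_Rintegral do rewrite big_cons.
by rewrite RintegralD// big_cons IHE RintegralZl.
Qed.

Lemma is_vintegral_mulmx (D : set (measurableTypeR R)) m n (M : 'M[R]_(m, n))
    (F : R -> 'cV[R]_n) (I : 'cV[R]_n) :
  measurable D -> is_vintegral D F I ->
  is_vintegral D (fun s => M *m F s) (M *m I).
Proof.
move=> mD FI i.
have [Hi HE] :=
  Rintegral_lincomb (index_enum 'I_n) (M i) mD (fun j => (FI j).1).
have E s : (M *m F s) i ord0 = \sum_j M i j * F s j ord0 by rewrite mxE.
split; first by apply: eq_integrable Hi => // s _; rewrite /= E.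
under eq_Rintegral do rewrite E.
by rewrite HE mxE; apply: eq_bigr => j _; rewrite (FI j).2.
Qed.

Lemma eq_is_vintegral (D : set (measurableTypeR R)) n
    (F G : R -> 'cV[R]_n) (I : 'cV[R]_n) :
  measurable D -> F =1 G -> is_vintegral D F I -> is_vintegral D G I.
Proof. by move=> mD FG; have -> : F = G by apply/funext. Qed.

Definition vprimitive n (h H : R -> 'cV[R]_n) :=
  forall j, primitive (fun s => h s j ord0) (fun t => H t j ord0).

Lemma vprimitive_itvNy n (h H : R -> 'cV[R]_n) :
  (forall t, is_vintegral `]-oo, t] h (H t)) -> vprimitive h H.
Proof.
move=> hH j; have -> : (fun t => H t j ord0) =
    fun t => \int[mu]_(s in `]-oo, t]) h s j ord0.
  by apply/funext => t; rewrite (hH t j).2.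
by apply: primitive_itvNy => t; exact: (hH t j).1.
Qed.

Lemma vprimitive_itvy n (h H : R -> 'cV[R]_n) :
  (forall t, is_vintegral `[t, +oo[ h (- H t)) -> vprimitive h H.
Proof.
move=> hH j; have -> : (fun t => H t j ord0) =
    fun t => - \int[mu]_(s in `[t, +oo[) h s j ord0.
  by apply/funext => t; rewrite -(hH t j).2 mxE opprK.
by apply: primitive_itvy => t; exact: (hH t j).1.
Qed.

Lemma vprimitive_continuous n (h H : R -> 'cV[R]_n) :
  vprimitive h H -> continuous H.
Proof.
move=> hH t; apply/cvg_mxP => i j; rewrite ord1.
exact: (primitive_continuous (hH i)).
Qed.

Lemma vprimitive_piece n (h H phi : R -> 'cV[R]_n) (a b : R) :
  vprimitive h H -> continuous phi -> {in `[a, b[, h =1 phi} ->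
  exists Phi : R -> 'cV[R]_n,
    (forall t : R, a <= t -> is_derive t 1 Phi (phi t)) /\
    {in `[a, b], H =1 Phi}.
Proof.
move=> hH cphi hphi.
have Phij j : exists Phi : R -> R,
    (forall t : R, a <= t -> is_derive t 1 Phi (phi t j ord0)) /\
    {in `[a, b], (fun t => H t j ord0) =1 Phi}.
  apply: primitive_piece (hH j) _ _ => [t|t tab]; last by rewrite hphi.
  exact: ((cvg_mxP _ _).1 (cphi t)).
have [Phi HPhi] := choice Phij.
exists (fun t => \col_j Phi j t); split=> [t at_|t tab].
  apply/is_derive_mxP => i j; rewrite ord1.
  by under eq_fun do rewrite mxE; exact: (HPhi i).1.
by apply/colP => i; rewrite mxE -(HPhi i).2.
Qed.

End vector_integrals.

(** * The variation of constants formula in both directions *)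

Section variation_of_constants.
Context {R : realType} {n : nat} (theta_ : int -> R) (theta : R).
Hypothesis theta_switching : switching_times theta_ theta.
Context (B : R -> 'M[R]_n) (U : R -> R -> 'M[R]_n).
Hypothesis UB : normalized_fundamental_matrix B U.

Lemma near_itv_le (a b t : R) : a < t < b -> \forall x \near t, a <= x <= b.
Proof.
move=> tab; have tin : t \in `]a, b[ by rewrite in_itv.
near=> x; have : x \in `]a, b[ by near: x; exact: near_in_itvoo.
by rewrite in_itv/= => /andP[/ltW-> /ltW->].
Unshelve. all: by end_near. Qed.

Lemma is_derive_vprimitive (h H : R -> 'cV[R]_n) i (t : R) :
  vprimitive h H -> piecewise_continuous theta_ h ->
  theta_ i < t < theta_ (i + 1) -> is_derive t 1 H (h t).
Proof.
move=> hH hpc it; have [phi cphi hphi] := hpc i.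
have [Phi [dPhi HPhi]] := vprimitive_piece hH cphi hphi.
have /andP[/ltW it0 ti] := it.
rewrite hphi ?in_itv/= ?it0//.
apply: near_eq_is_derive (dPhi t it0).
by near=> x; apply/esym/HPhi; rewrite in_itv/=; near: x; exact: near_itv_le.
Unshelve. all: by end_near. Qed.

Lemma fundamental_continuous (s : R) : continuous (U s).
Proof.
move=> t; apply: derivable_continuous.
by have [] := is_derive_fundamental_snd UB s t.
Qed.

Lemma piecewise_continuous_mulmx m (M : R -> 'M[R]_(m, n)) (g : R -> 'cV[R]_n) :
  continuous M -> piecewise_continuous theta_ g ->
  piecewise_continuous theta_ (fun s => M s *m g s).
Proof.
move=> cM gpc i; have [phi cphi gphi] := gpc i.
exists (fun s => M s *m phi s); last by move=> s si; rewrite /= gphi.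
by move=> t; apply: cvg_mulmx; [exact: cM|exact: cphi].
Qed.

Lemma variation_of_constants (g H u : R -> 'cV[R]_n) :
  piecewise_continuous theta_ g ->
  vprimitive (fun s => U 0 s *m g s) H -> continuous u ->
  (forall (i : int) (t : R), theta_ i < t < theta_ (i + 1) ->
     is_derive t 1 u (B t *m u t + g t)) ->
  exists c, forall t, u t = U t 0 *m (c + H t).
Proof.
move=> gpc gH cu du.
pose W t := U 0 t *m u t.
have cW : continuous W.
  by move=> t; apply: cvg_mulmx; [exact: fundamental_continuous|exact: cu].
have dW i (t : R) : theta_ i < t < theta_ (i + 1) ->
    is_derive t 1 W (U 0 t *m g t).
  move=> it.
  (* The adjoint equation contributes [- U 0 t *m B t *m u t], which cancels the linear part of the
     derivative of [u]. *)
  have := is_derive_mulmx (is_derive_fundamental_snd UB 0 t) (du i t it).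
  by rewrite mulmxDr mulNmx mulmxA addKr.
have WH s t : W s - H s = W t - H t.
  apply/matrixP => j k; rewrite ord1.
  have E x : (W x - H x) j ord0 = W x j ord0 - H x j ord0 by rewrite !mxE.
  rewrite !E; apply: (piecewise_derive0_cst theta_switching
    (D := fun x => W x j ord0 - H x j ord0)) => [x|i x ix].
    apply: cvgB; first exact: ((cvg_mxP _ _).1 (cW x)).
    exact: (primitive_continuous (gH j)).
  have dWj := (is_derive_mxP _ _ _).1 (dW i x ix) j ord0.
  have gpc0 := piecewise_continuous_mulmx (@fundamental_continuous 0) gpc.
  have dHj := (is_derive_mxP _ _ _).1 (is_derive_vprimitive gH gpc0 ix) j ord0.
  by have := is_deriveB dWj dHj; rewrite subrr.
exists (W 0 - H 0) => t.
by rewrite (WH 0 t) subrK mulmxA (fundamental_mulV UB) mul1mx.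
Qed.

(** On each closed cell [u] agrees with a function [w] that is differentiable in the two-sided sense
    even at [theta_ i]; its derivative there is the right derivative of [u]. *)
Lemma variation_of_constants_solution (g H u : R -> 'cV[R]_n) :
  piecewise_continuous theta_ g ->
  vprimitive (fun s => U 0 s *m g s) H ->
  (forall t, u t = U t 0 *m H t) ->
  (forall (i : int) (t : R), theta_ i < t < theta_ (i + 1) ->
     is_derive t 1 u (B t *m u t + g t)) /\
  (forall i : int, right_derivative u (theta_ i)
     (B (theta_ i) *m u (theta_ i) + g (theta_ i))).
Proof.
move=> gpc gH uE.
have key i : exists w : R -> 'cV[R]_n,
    {in `[theta_ i, theta_ (i + 1)], u =1 w} /\
    (forall t : R, theta_ i <= t < theta_ (i + 1) ->
       is_derive t 1 w (B t *m u t + g t)).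
  have [phi cphi hphi] :=
    piecewise_continuous_mulmx (@fundamental_continuous 0) gpc i.
  have [Phi [dPhi HPhi]] := vprimitive_piece gH cphi hphi.
  exists (fun t => U t 0 *m Phi t); split=> [t ti|t /andP[it ti]].
    by rewrite uE HPhi.
  have := is_derive_mulmx (((UB 0).1 t).2) (dPhi t it).
  rewrite -hphi ?in_itv/= ?it// -HPhi ?in_itv/= ?it ?ltW//.
  by rewrite -mulmxA -uE mulmxA (fundamental_mulV UB) mul1mx.
split=> [i t it|i]; have [w [uw dw]] := key i.
  have /andP[/ltW it0 ti] := it.
  apply: near_eq_is_derive (dw t _); last by rewrite it0.
  by near=> x; apply/esym/uw; rewrite in_itv/=; near: x; exact: near_itv_le.
have lti := switching_lt theta_switching i.
have [dwi dwE] : is_derive (theta_ i) 1 w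
    (B (theta_ i) *m u (theta_ i) + g (theta_ i)).
  by apply: dw; rewrite lexx.
rewrite /right_derivative -dwE; move: dwi.
move=> /cvg_dnbhs_at_right.
apply: cvg_trans; apply: near_eq_cvg.
(* Only [h] below the cell length count, so that [theta_ i + h] stays where [u] and [w] agree. *)
near=> h.
have h0 : 0 < h by [].
have hlt : h < theta_ (i + 1) - theta_ i.
  by near: h; apply: nbhs_right_lt; rewrite subr_gt0.
have -> : h *: (1 : R) = h by rewrite /GRing.scale/= mulr1.
rewrite !uw ?in_itv/= ?lexx ?ltW//; first by rewrite (addrC h).
  by rewrite -ltrBrDl.
by rewrite ltrDl.
Unshelve. all: by end_near. Qed.

End variation_of_constants.

(** * Bounded solutions *)


Section bounded_solutions.
Context {R : realType} {n : nat} (theta_ : int -> R) (theta : R).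
Hypothesis theta_switching : switching_times theta_ theta.
Context (B : R -> 'M[R]_n) (U : R -> R -> 'M[R]_n).
Hypothesis UB : normalized_fundamental_matrix B U.
Context (K sigma : R) (K0 : 0 < K) (sigma0 : 0 < sigma).
Context (g : R -> 'cV[R]_n) (G : R) (G0 : 0 <= G).
Hypothesis gpc : piecewise_continuous theta_ g.
Hypothesis gG : forall t j, `|g t j ord0| <= G.
Notation mu := (@lebesgue_measure R).

(** Each coordinate of the integrand is a sum of [n] terms of modulus at most [K * e s * G]. The
    abstract weight [e] serves both half-lines, and the bound on [J] does not depend on [t]. *)
Lemma fundamental_vintegral (D : set (measurableTypeR R)) (e : R -> R) (t : R) :
  measurable D -> continuous e -> (forall s, 0 <= e s) ->
  (\int[mu]_(s in D) (e s)%:E = (sigma^-1)%:E)%E ->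
  (forall s, D s -> opnorm (U t s) <= K * e s) ->
  exists J : 'cV[R]_n, is_vintegral D (fun s => U t s *m g s) J /\
    forall j, `|J j ord0| <= n%:R * (K * G) * sigma^-1.
Proof.
move=> mD ce e0 eE Ue.
pose h j s := (U t s *m g s) j ord0.
have hb j : mu.-integrable D (EFin \o h j) /\
    `|\int[mu]_(s in D) h j s| <= n%:R * (K * G) * sigma^-1.
  apply: (@dominated_Rintegral _ D e) => //.
  - exact: continuous_measurable_fun.
  - apply: (piecewise_continuous_measurable theta_switching) => i.
    have [phi cphi gphi] :=
      piecewise_continuous_mulmx (@fundamental_continuous _ _ _ _ UB t) gpc i.
    exists (fun s => phi s j ord0); last by move=> s si; rewrite /h gphi.
    by move=> s; exact: ((cvg_mxP _ _).1 (cphi s)).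
  - move=> s Ds; rewrite /h mxE (le_trans (ler_norm_sum _ _ _))//.
    apply: (@le_trans _ _ (\sum_(k < n) K * e s * G)).
      apply: ler_sum => k _; rewrite normrM ler_pM//.
      exact: le_trans (normr_coord_le_opnorm _ _ _) (Ue s Ds).
    by rewrite sumr_const card_ord -[leLHS]mulr_natl (mulrAC K) [leLHS]mulrA.
exists (\col_j \int[mu]_(s in D) h j s).
split=> j; last by rewrite mxE (hb j).2.
by rewrite mxE; split=> //; exact: (hb j).1.
Qed.

(** Every coordinate of [c] is at most [n * K * C] times [expR (- sigma * s)], for all [s >= 0]. *)
Lemma expR_decay_eq0 (c : 'cV[R]_n) (M : R -> 'M[R]_n) (y : R -> 'cV[R]_n)
    (C : R) : 0 <= C ->
  (forall s, 0 <= s -> c = M s *m y s) ->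
  (forall s, 0 <= s -> opnorm (M s) <= K * expR (- sigma * s)) ->
  (forall s j, `|y s j ord0| <= C) -> c = 0.
Proof.
move=> C0 cE MK yC; apply/colP => i; rewrite mxE.
apply: (@expR_bounded_eq0 _ _ (n%:R * (K * C)) sigma) => // s s0.
rewrite -ler_pdivlMr ?expR_gt0// -expRN -mulNr (cE s s0) mxE.
rewrite (le_trans (ler_norm_sum _ _ _))//.
apply: (@le_trans _ _ (\sum_(k < n) K * expR (- sigma * s) * C)).
  apply: ler_sum => k _; rewrite normrM ler_pM//.
  exact: le_trans (normr_coord_le_opnorm _ _ _) (MK s s0).
by rewrite sumr_const card_ord -[leLHS]mulr_natl (mulrAC K) [leLHS]mulrA.
Qed.

Context (u : R -> 'cV[R]_n).

(** The cocycle identity frees the integrand from [t], so that the integrals for different [t]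
    become values of one primitive. *)
Lemma is_vintegral_fundamental0 (D : set (measurableTypeR R)) (t : R) J :
  measurable D -> is_vintegral D (fun s => U t s *m g s) J ->
  is_vintegral D (fun s => U 0 s *m g s) (U 0 t *m J).
Proof.
move=> mD; move/(is_vintegral_mulmx (U 0 t) mD); apply: eq_is_vintegral => //.
by move=> s; rewrite mulmxA (fundamental_mul UB).
Qed.

(** [u] differs from the half-line integral [J] by [U t 0 *m c]; both are bounded, which leaves only
    [c = 0]. *)
Lemma bounded_solution_integral_itvNy (C : R) : 0 <= C ->
  (forall t s : R, s <= t -> opnorm (U t s) <= K * expR (- sigma * (t - s))) ->
  (forall t j, `|u t j ord0| <= C) -> continuous u ->
  (forall (i : int) (t : R), theta_ i < t < theta_ (i + 1) ->
     is_derive t 1 u (B t *m u t + g t)) ->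
  forall t, is_vintegral `]-oo, t] (fun s => U t s *m g s) (u t).
Proof.
move=> C0 UK uC cu du.
have HJ t : exists J : 'cV[R]_n,
    is_vintegral `]-oo, t] (fun s => U t s *m g s) J /\
    forall j, `|J j ord0| <= n%:R * (K * G) * sigma^-1.
  apply: (@fundamental_vintegral _ (fun s => expR (- sigma * (t - s)))) => //.
  - move=> x; apply: continuous_comp; last exact: continuous_expR.
    by apply: cvgM; [exact: cvg_cst|apply: cvgB; [exact: cvg_cst|exact: cvg_id]].
  - exact: integral_expR_itvNy.
  - by move=> s /=; rewrite in_itv/= => st; exact: UK.
have [J {}HJ] := choice HJ.
have pJ : vprimitive (fun s => U 0 s *m g s) (fun t => U 0 t *m J t).
  apply: vprimitive_itvNy => t.
  by apply: is_vintegral_fundamental0 => //; exact: (HJ t).1.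
have [c uE] := variation_of_constants theta_switching UB gpc pJ cu du.
have {}uE t : u t = U t 0 *m c + J t.
  by rewrite uE mulmxDr mulmxA (fundamental_mulV UB) mul1mx.
suff c0 : c = 0 by move=> t; rewrite uE c0 mulmx0 add0r; exact: (HJ t).1.
(* The time is reflected because [U 0 t] decays as [t] goes to [-oo]. *)
apply: (@expR_decay_eq0 _ (fun s => U 0 (- s)) (fun s => u (- s) - J (- s))
  (C + n%:R * (K * G) * sigma^-1)).
- by rewrite addr_ge0// !mulr_ge0// ?invr_ge0 ltW.
- by move=> s s0; rewrite uE addrK mulmxA (fundamental_mulV UB) mul1mx.
- by move=> s s0; have := @UK 0 (- s); rewrite oppr_le0 opprK add0r; apply.
- move=> s j; rewrite !mxE (le_trans (ler_normB _ _))// lerD//.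
  exact: (HJ (- s)).2.
Qed.

(** Mirror image of the previous argument: the tail integral decreases with its base point, so [- J]
    replaces [J], and the decay of [U 0 s] is now at [+oo]. *)
Lemma bounded_solution_integral_itvy (C : R) : 0 <= C ->
  (forall t s : R, t <= s -> opnorm (U t s) <= K * expR (- sigma * (s - t))) ->
  (forall t j, `|u t j ord0| <= C) -> continuous u ->
  (forall (i : int) (t : R), theta_ i < t < theta_ (i + 1) ->
     is_derive t 1 u (B t *m u t + g t)) ->
  forall t, is_vintegral `[t, +oo[ (fun s => U t s *m g s) (- u t).
Proof.
move=> C0 UK uC cu du.
have HJ t : exists J : 'cV[R]_n,
    is_vintegral `[t, +oo[ (fun s => U t s *m g s) J /\
    forall j, `|J j ord0| <= n%:R * (K * G) * sigma^-1.
  apply: (@fundamental_vintegral _ (fun s => expR (- sigma * (s - t)))) => //.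
  - move=> x; apply: continuous_comp; last exact: continuous_expR.
    by apply: cvgM; [exact: cvg_cst|apply: cvgB; [exact: cvg_id|exact: cvg_cst]].
  - exact: integral_expR_itvy.
  - by move=> s /=; rewrite in_itv/= andbT => st; exact: UK.
have [J {}HJ] := choice HJ.
have pJ : vprimitive (fun s => U 0 s *m g s) (fun t => - (U 0 t *m J t)).
  apply: vprimitive_itvy => t; rewrite opprK.
  by apply: is_vintegral_fundamental0 => //; exact: (HJ t).1.
have [c uE] := variation_of_constants theta_switching UB gpc pJ cu du.
have {}uE t : u t = U t 0 *m c - J t.
  by rewrite uE mulmxBr mulmxA (fundamental_mulV UB) mul1mx.
suff c0 : c = 0.
  by move=> t; rewrite uE c0 mulmx0 sub0r opprK; exact: (HJ t).1.
apply: (@expR_decay_eq0 _ (U 0) (fun s => u s + J s)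
  (C + n%:R * (K * G) * sigma^-1)).
- by rewrite addr_ge0// !mulr_ge0// ?invr_ge0 ltW.
- by move=> s s0; rewrite uE subrK mulmxA (fundamental_mulV UB) mul1mx.
- by move=> s s0; have := @UK 0 s s0; rewrite subr0.
- move=> s j; rewrite !mxE (le_trans (ler_normD _ _))// lerD//.
  exact: (HJ s).2.
Qed.

End bounded_solutions.

(** * From the integral equations back to primitives *)

Section integral_equations.
Context {R : realType} {n : nat} (theta_ : int -> R) (theta : R).
Hypothesis theta_switching : switching_times theta_ theta.
Context (B : R -> 'M[R]_n) (U : R -> R -> 'M[R]_n).
Hypothesis UB : normalized_fundamental_matrix B U.
Context (g u : R -> 'cV[R]_n).

Lemma vprimitive_integral_itvNy :
  (forall t, is_vintegral `]-oo, t] (fun s => U t s *m g s) (u t)) ->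
  vprimitive (fun s => U 0 s *m g s) (fun t => U 0 t *m u t).
Proof.
move=> uE; apply: vprimitive_itvNy => t.
exact: (is_vintegral_fundamental0 UB).
Qed.

Lemma vprimitive_integral_itvy :
  (forall t, is_vintegral `[t, +oo[ (fun s => U t s *m g s) (- u t)) ->
  vprimitive (fun s => U 0 s *m g s) (fun t => U 0 t *m u t).
Proof.
move=> uE; apply: vprimitive_itvy => t; rewrite -mulmxN.
exact: (is_vintegral_fundamental0 UB).
Qed.

(** The integral equations presuppose no continuity of [u]; it comes from the continuity of the
    primitive [U 0 t *m u t]. *)
Lemma vprimitive_fundamental_continuous :
  vprimitive (fun s => U 0 s *m g s) (fun t => U 0 t *m u t) -> continuous u.
Proof.
move=> /vprimitive_continuous cW.
have -> : u = fun t => U t 0 *m (U 0 t *m u t).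
  by apply/funext => t; rewrite mulmxA (fundamental_mulV UB) mul1mx.
move=> t; apply: cvg_mulmx; last exact: cW.
by apply: derivable_continuous; have [_ []] := (UB 0).1 t.
Qed.

End integral_equations.

Section nonlinearity.
Context {R : realType}.

(** The increment splits into a change of [y] at fixed time, small by the Lipschitz bound uniformly
    in time, and a change of time at fixed [y t]. *)
Lemma lipschitz_comp_continuous m n (F : R -> 'cV[R]_n -> 'cV[R]_m)
    (y : R -> 'cV[R]_n) (lip : R) :
  (forall y0, continuous (F ^~ y0)) ->
  (forall t y1 y2, enorm (F t y1 - F t y2) <= lip * enorm (y1 - y2)) ->
  continuous y -> continuous (fun t => F t (y t)).
Proof.
move=> cF lipF cy t.
have enormE p (x : 'cV[R]_p) : enorm x <= p%:R * `|x|.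
  apply: enorm_le_coord => // i.
  rewrite [leRHS]/Num.Def.normr/= mx_normrE.
  exact: (le_bigmax _ _ (i, ord0)).
have Fy0 : F s (y s) - F s (y t) @[s --> t] --> (0 : 'cV[R]_m).
  apply/cvg_mxP => i j; rewrite ord1 mxE.
  have yt0 : `|y s - y t| @[s --> t] --> (0 : R).
    rewrite -(normr0 'cV[R]_n) -(subrr (y t)); apply: cvg_norm.
    by apply: cvgB; [exact: cy|exact: cvg_cst].
  have b0 : `|lip| * n%:R * `|y s - y t| @[s --> t] --> (0 : R).
    rewrite -(mulr0 (`|lip| * n%:R)).
    by apply: cvgM; [exact: cvg_cst|exact: yt0].
  apply/norm_cvg0P; apply: (squeeze_cvgr _ (cvg_cst 0) b0).
  near=> s; rewrite normr_ge0/= (le_trans (normr_coord_le_enorm _ _))//.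
  rewrite (le_trans (lipF _ _ _))//.
  apply: (@le_trans _ _ (`|lip| * enorm (y s - y t))).
    by rewrite ler_wpM2r ?sqrtr_ge0// ler_norm.
  by rewrite -mulrA ler_wpM2l.
have : F s (y s) - F s (y t) + F s (y t) @[s --> t] --> 0 + F t (y t).
  by apply: cvgD; [exact: Fy0|exact: cF].
by rewrite add0r; under eq_fun do rewrite subrK.
Unshelve. all: by end_near. Qed.

End nonlinearity.

(** * The reduced system *)


Section reduced_nonlinearity.
Context {R : realType} {n : nat} (theta_ : int -> R) (beta : R -> R).
Context (f : R -> 'cV[R]_n -> 'cV[R]_n -> 'cV[R]_n) (lip : R).
Context (Q : R -> 'M[R]_n) (z : R -> 'cV[R]_n).
Hypothesis beta_switching : switching_function theta_ beta.
Hypothesis cf : forall y w : 'cV[R]_n, continuous (fun t => f t y w).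
Hypothesis f0 : forall t : R, f t 0 0 = 0.
Hypothesis flip : forall (t : R) (y1 w1 y2 w2 : 'cV[R]_n),
  enorm (f t y1 w1 - f t y2 w2) <= lip * (enorm (y1 - y2) + enorm (w1 - w2)).
Hypothesis lyapunovQ : lyapunov_matrix Q.

Let g t := reduced_nonlinearity Q beta f t (z t) (z (beta t)).

Lemma mxbounded_entry m p (M : R -> 'M[R]_(m, p)) : mxbounded M ->
  exists2 c : R, 0 <= c & forall t i j, `|M t i j| <= c.
Proof.
move=> [c Mc]; exists `|c| => // t i j.
rewrite (le_trans (normr_coord_le_opnorm _ _ _))//.
by rewrite (le_trans (Mc t))// ler_norm.
Qed.

(** Comparing [f] with its value 0 at the origin turns the Lipschitz bound into linear growth; [Q]
    and its inverse are bounded. *)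
Lemma reduced_nonlinearity_bounded (C : R) : 0 <= C ->
  (forall t j, `|z t j ord0| <= C) ->
  exists2 G : R, 0 <= G & forall t j, `|g t j ord0| <= G.
Proof.
move=> C0 zC; have [_ _ _ [bQ _ bQV]] := lyapunovQ.
have [q q0 Qq] := mxbounded_entry bQ; have [r r0 Qr] := mxbounded_entry bQV.
pose a := n%:R * (n%:R * (q * C)).
have a0 : 0 <= a by rewrite !mulr_ge0.
have Qz s s' : enorm (Q s *m z s') <= a by exact: enorm_mulmx_le.
exists (n%:R * (n%:R * (r * (`|lip| * (a + a))))) => [|t j].
  by rewrite !mulr_ge0// addr_ge0.
rewrite (le_trans (normr_coord_le_enorm _ _))//.
apply: enorm_mulmx_le => //; first by rewrite mulr_ge0// addr_ge0.
move=> i; rewrite (le_trans (normr_coord_le_enorm _ _))//.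
rewrite -[X in enorm X]subr0 -(f0 t) (le_trans (flip _ _ _ _ _))// !subr0.
apply: le_trans (ler_wpM2r _ (ler_norm lip)) _.
  by rewrite addr_ge0 ?sqrtr_ge0.
by rewrite ler_wpM2l// lerD.
Qed.

(** On a cell the delayed argument is the fixed vector [w], and with [w] frozen the formula is
    continuous on the whole line. *)
Lemma reduced_nonlinearity_piecewise :
  continuous z -> piecewise_continuous theta_ g.
Proof.
move=> cz i; have [uQ dQ _ _] := lyapunovQ.
pose w := Q (theta_ i) *m z (theta_ i).
exists (fun s => invmx (Q s) *m f s (Q s *m z s) w).
  move=> t; apply: cvg_mulmx.
    by apply: derivable_continuous; exact: derivable_invmx.
  apply: (@lipschitz_comp_continuous _ _ _ (fun s y => f s y w) _ lip).
  - by move=> y; exact: cf.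
  - move=> s y1 y2; apply: le_trans (flip _ _ _ _ _) _.
    suff -> : enorm (w - w) = 0 by rewrite addr0.
    by rewrite subrr /enorm big1 ?sqrtr0// => j _; rewrite mxE expr0n.
  - by move=> s; apply: cvg_mulmx; [exact: derivable_continuous|exact: cz].
move=> s; rewrite in_itv/= => si.
by rewrite /g /reduced_nonlinearity (beta_switching si).
Qed.

End reduced_nonlinearity.

(** * Splitting column vectors into the two blocks *)

Section blocks.
Context {R : realType} {k l : nat} (theta_ : int -> R).

Lemma piecewise_continuous_usubmx (g : R -> 'cV[R]_(k + l)) :
  piecewise_continuous theta_ g ->
  piecewise_continuous theta_ (fun t => usubmx (g t) : 'cV[R]_k).
Proof.
move=> gpc i; have [phi cphi gphi] := gpc i.
exists (fun t => usubmx (phi t)); last by move=> s si; rewrite /= gphi.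
move=> t; apply/cvg_mxP => a b; rewrite mxE; under eq_fun do rewrite mxE.
exact: ((cvg_mxP _ _).1 (cphi t)).
Qed.

Lemma piecewise_continuous_dsubmx (g : R -> 'cV[R]_(k + l)) :
  piecewise_continuous theta_ g ->
  piecewise_continuous theta_ (fun t => dsubmx (g t) : 'cV[R]_l).
Proof.
move=> gpc i; have [phi cphi gphi] := gpc i.
exists (fun t => dsubmx (phi t)); last by move=> s si; rewrite /= gphi.
move=> t; apply/cvg_mxP => a b; rewrite mxE; under eq_fun do rewrite mxE.
exact: ((cvg_mxP _ _).1 (cphi t)).
Qed.

Lemma continuous_col_mx (u : R -> 'cV[R]_k) (v : R -> 'cV[R]_l) :
  continuous (fun t => col_mx (u t) (v t)) <-> continuous u /\ continuous v.
Proof.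
split=> [cz|[cu cv] t].
  split=> t; apply/cvg_mxP => a b.
    rewrite -(col_mxEu _ (v t)).
    have -> : (fun s => u s a b) = fun s => col_mx (u s) (v s) (lshift l a) b.
      by apply/funext => s; rewrite col_mxEu.
    exact: ((cvg_mxP _ _).1 (cz t)).
  rewrite -(col_mxEd (u t)).
  have -> : (fun s => v s a b) = fun s => col_mx (u s) (v s) (rshift k a) b.
    by apply/funext => s; rewrite col_mxEd.
  exact: ((cvg_mxP _ _).1 (cz t)).
apply/cvg_mxP => a b; case: (split_ordP a) => j ->.
  rewrite col_mxEu; under eq_fun do rewrite col_mxEu.
  exact: ((cvg_mxP _ _).1 (cu t)).
rewrite col_mxEd; under eq_fun do rewrite col_mxEd.
exact: ((cvg_mxP _ _).1 (cv t)).
Qed.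

End blocks.

Theorem lemma2p5 (R : realType) (k l : nat)
  (theta_ : int -> R) (theta : R) (beta : R -> R)
  (A : R -> 'M[R]_(k + l)) (mu : R)
  (f : R -> 'cV[R]_(k + l) -> 'cV[R]_(k + l) -> 'cV[R]_(k + l)) (lip : R)
  (X : R -> 'M[R]_(k + l)) (P : 'M[R]_(k + l)) (K sigma : R)
  (Q : R -> 'M[R]_(k + l)) (Bp : R -> 'M[R]_k) (Bm : R -> 'M[R]_l)
  (U : R -> R -> 'M[R]_k) (V : R -> R -> 'M[R]_l) :
  0 < theta ->
  switching_times theta_ theta ->
  switching_function theta_ beta ->
  continuous A ->
  ereal_sup [set (opnorm (A t))%:E | t in [set: R]] = mu%:E ->
  (forall y w : 'cV[R]_(k + l), continuous (fun t => f t y w)) ->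
  (forall t : R, f t 0 0 = 0) ->
  (forall (t : R) (y1 w1 y2 w2 : 'cV[R]_(k + l)),
     enorm (f t y1 w1 - f t y2 w2) <= lip * (enorm (y1 - y2) + enorm (w1 - w2))) ->
  0 < K -> 0 < sigma ->
  exp_dichotomy A X P K sigma ->
  (let M := expR (mu * theta) in
   let m := expR (- mu * theta) in
   lip * M * theta * (1 + M * (1 + lip * theta) * expR (M * lip * theta)) < m) ->
  \rank P = k ->
  lyapunov_matrix Q ->
  block_diagonalizes A Q Bp Bm ->
  normalized_fundamental_matrix Bp U ->
  normalized_fundamental_matrix Bm V ->
  (forall t s : R, s <= t -> opnorm (U t s) <= K * expR (- sigma * (t - s))) ->
  (forall t s : R, t <= s -> opnorm (V t s) <= K * expR (- sigma * (s - t))) ->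
  let g := reduced_nonlinearity Q beta f in
  let gp t z w := usubmx (g t z w) in
  let gm t z w := dsubmx (g t z w) in
  forall (u : R -> 'cV[R]_k) (v : R -> 'cV[R]_l),
    vbounded (fun t => col_mx (u t) (v t)) ->
    (reduced_solution theta_ beta Bp Bm gp gm u v <->
     integral_solution beta U V gp gm u v).
Proof.
move=> _ switching beta_switching _ _ cf f0 flip K0 sigma0 _ _ _ lyapunovQ _.
move=> UB VB UK VK g gp gm u v [C zC].
pose z t := col_mx (u t) (v t).
have C0 : 0 <= C := le_trans (sqrtr_ge0 _) (zC 0).
have zC' t j : `|z t j ord0| <= C := le_trans (normr_coord_le_enorm _ _) (zC t).
have uC t j : `|u t j ord0| <= C by have := zC' t (lshift l j); rewrite col_mxEu.
have vC t j : `|v t j ord0| <= C by have := zC' t (rshift k j); rewrite col_mxEd.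
have [G G0 gG] :=
  reduced_nonlinearity_bounded beta f0 flip lyapunovQ C0 zC'.
pose gu t := gp t (z t) (z (beta t)); pose gv t := gm t (z t) (z (beta t)).
have guG t j : `|gu t j ord0| <= G by rewrite /gu /gp mxE; exact: gG.
have gvG t j : `|gv t j ord0| <= G by rewrite /gv /gm mxE; exact: gG.
(* Continuity of [z] stays a premise: for a solution of the integral equations it is available only
   after the primitives are. *)
have pc : continuous z ->
    piecewise_continuous theta_ gu /\ piecewise_continuous theta_ gv.
  move=> /(reduced_nonlinearity_piecewise beta_switching cf flip lyapunovQ) gpc.
  split; first exact: piecewise_continuous_usubmx gpc.
  exact: piecewise_continuous_dsubmx gpc.
split=> [[cz dz _] t|uvE].
  have [gupc gvpc] := pc cz; have [cu cv] := (continuous_col_mx u v).1 cz.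
  split.
    apply: (bounded_solution_integral_itvNy switching UB K0 sigma0 G0 gupc guG
      C0 UK uC cu) => i s si.
    exact: (dz i s si).1.
  apply: (bounded_solution_integral_itvy switching VB K0 sigma0 G0 gvpc gvG
    C0 VK vC cv) => i s si.
  exact: (dz i s si).2.
(* The primitives rest only on the integrability asserted in the integral equations, so deriving
   continuity of [z] from them is not circular. *)
have pu := vprimitive_integral_itvNy UB (fun t => (uvE t).1).
have pv := vprimitive_integral_itvy VB (fun t => (uvE t).2).
have cz : continuous z.
  apply/continuous_col_mx; split.
    exact: (vprimitive_fundamental_continuous UB pu).
  exact: (vprimitive_fundamental_continuous VB pv).
have [gupc gvpc] := pc cz.
(* The primitive is [U 0 t *m u t] itself, so the representation of [u] required here is the cocycle
   identity. *)
have [|du rdu] := variation_of_constants_solution (u := u) switching UB gupc pu.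
  by move=> t; rewrite mulmxA (fundamental_mulV UB) mul1mx.
have [|dv rdv] := variation_of_constants_solution (u := v) switching VB gvpc pv.
  by move=> t; rewrite mulmxA (fundamental_mulV VB) mul1mx.
split=> [//|i t ti|i]; first by split; [exact: du ti|exact: dv ti].
by split; [exact: rdu|exact: rdv].
Qed.
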